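(* Consider the following two-player zero-sum recursive game in which player 2 observes the state variable and the past actions played, whereas player 1 observes neither the state nor the actions played by the other player. States: $X=\{s_2,s_3,0^*,(-1/2)^*,-1^*,2^*\}$; actions of player 1: $I=\{T,B\}$; actions of player 2: $J=\{L,R\}$. The states $k^*$ ($k\in\{0,-1/2,-1,2\}$) are absorbing with stage payoff $k$; the stage payoff in $s_2,s_3$ is $0$. Transitions: - in $s_2$: $(T,L)$ leads to $s_2$; $(T,R)$ leads to $-1^*$ with probability $1/2$ and to $s_3$ with probability $1/2$; $(B,L)$ leads to $(-1/2)^*$; $(B,R)$ leads to $0^*$; - in $s_3$: if player 1 plays $T$ the state stays $s_3$, if player 1 plays $B$ the state moves to $2^*$ (whatever player 2 plays). Then the game which starts in $s_2$ has no limsup value: $\underline v^*=-\tfrac12<-\tfrac16=\overline v^*$.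
   Context: The initial state $s_2$ is fixed and known. At each stage $n\ge1$ the players independently choose $i_n\in I$ and $j_n\in J$, the stage payoff (paid to player 1) is $g(x_n,i_n,j_n)$ and the next state $x_{n+1}$ is drawn from the transition. Player 1 gets no signal (he remembers only his own past actions): a behavioral strategy of player 1 is a sequence $\sigma=(\sigma_n)_{n\ge1}$ with $\sigma_n:I^{n-1}\to\Delta(I)$. Player 2 observes the current state and all past actions: a behavioral strategy of player 2 is a sequence $\tau=(\tau_n)_{n\ge1}$ with $\tau_n:(X\times I\times J)^{n-1}\times X\to\Delta(J)$. $\mathbb E_{\sigma,\tau}$ is the expectation for the induced probability on plays. With the limsup evaluation $\gamma^*(h)=\limsup_n g(x_n,i_n,j_n)$, $\underline v^*=\sup_\sigma\inf_\tau\mathbb E_{\sigma,\tau}(\gamma^* )$ and $\overline v^*=\inf_\tau\sup_\sigma\mathbb E_{\sigma,\tau}(\gamma^* )$; the limsup value exists if these are equal. *)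

(* Defs.v *)
From HB Require Import structures.
From mathcomp Require Import all_boot all_order all_algebra.
From mathcomp Require Import all_classical all_reals all_analysis.

Set Implicit Arguments.
Unset Strict Implicit.
Unset Printing Implicit Defensive.

Import Order.TTheory GRing.Theory Num.Theory.
Import numFieldNormedType.Exports.
Local Open Scope classical_set_scope.
Local Open Scope ring_scope.

(* [abs_0], [abs_mhalf], [abs_m1], [abs_2] are the absorbing states 0^*,
   (-1/2)^*, -1^*, 2^*. *)
Inductive state := s2 | s3 | abs_0 | abs_mhalf | abs_m1 | abs_2.
Inductive action1 := Top | Bottom.
Inductive action2 := Left | Right.

Definition nat_of_state (x : state) : 'I_6 :=
  inord match x with
  | s2 => 0 | s3 => 1 | abs_0 => 2 | abs_mhalf => 3 | abs_m1 => 4 | abs_2 => 5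
  end.
Definition state_of_nat (k : 'I_6) : state :=
  nth s2 [:: s2; s3; abs_0; abs_mhalf; abs_m1; abs_2] k.
Lemma nat_of_stateK : cancel nat_of_state state_of_nat.
Proof. by case; rewrite /state_of_nat /nat_of_state inordK. Qed.
HB.instance Definition _ := Finite.copy state (can_type nat_of_stateK).
HB.instance Definition _ := isPointed.Build state s2.

Definition bool_of_action1 (i : action1) : bool :=
  if i is Top then true else false.
Definition action1_of_bool (b : bool) : action1 := if b then Top else Bottom.
Lemma bool_of_action1K : cancel bool_of_action1 action1_of_bool.
Proof. by case. Qed.
HB.instance Definition _ := Finite.copy action1 (can_type bool_of_action1K).
HB.instance Definition _ := isPointed.Build action1 Top.

Definition bool_of_action2 (j : action2) : bool :=
  if j is Left then true else false.
Definition action2_of_bool (b : bool) : action2 := if b then Left else Right.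
Lemma bool_of_action2K : cancel bool_of_action2 action2_of_bool.
Proof. by case. Qed.
HB.instance Definition _ := Finite.copy action2 (can_type bool_of_action2K).
HB.instance Definition _ := isPointed.Build action2 Left.

(* The simplex Delta(A). *)
Record dist (R : realType) (A : finType) := Dist {
  prob :> A -> R;
  prob_ge0 : forall a, 0 <= prob a;
  prob_sum1 : \sum_a prob a = 1 }.

Section game.
Context (R : realType).

Lemma point_dist_ge0 (A : finType) (a b : A) : 0 <= (b == a)%:R :> R.
Proof. exact: ler0n. Qed.
Lemma point_dist_sum1 (A : finType) (a : A) : \sum_b (b == a)%:R = 1 :> R.
Proof.
rewrite (bigD1 a)//= eqxx big1 ?addr0// => b /negPf ->.
by [].
Qed.
Definition point_dist (A : finType) (a : A) : dist R A :=
  Dist (@point_dist_ge0 A a) (@point_dist_sum1 A a).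

Lemma half_dist_ge0 (A : finType) (a b c : A) :
  0 <= 2^-1 * point_dist a c + 2^-1 * point_dist b c.
Proof. by rewrite addr_ge0// mulr_ge0// ?invr_ge0// prob_ge0. Qed.
Lemma half_dist_sum1 (A : finType) (a b : A) :
  \sum_c (2^-1 * point_dist a c + 2^-1 * point_dist b c) = 1.
Proof.
rewrite big_split/= -!mulr_sumr !point_dist_sum1 mulr1 -[2^-1]mul1r.
by rewrite -splitr.
Qed.
Definition half_dist (A : finType) (a b : A) : dist R A :=
  Dist (@half_dist_ge0 A a b) (@half_dist_sum1 A a b).

Definition transition (x : state) (i : action1) (j : action2) : dist R state :=
  match x, i, j with
  | s2, Top, Left => point_dist s2
  | s2, Top, Right => half_dist abs_m1 s3
  | s2, Bottom, Left => point_dist abs_mhalf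
  | s2, Bottom, Right => point_dist abs_0
  | s3, Top, _ => point_dist s3
  | s3, Bottom, _ => point_dist abs_2
  | _, _, _ => point_dist x
  end.

Definition stage_payoff (x : state) (i : action1) (j : action2) : R :=
  match x with
  | s2 | s3 | abs_0 => 0
  | abs_mhalf => - (1 / 2)
  | abs_m1 => - 1
  | abs_2 => 2
  end.

(* A stage is (x_n, i_n, j_n); a finite history lists the past stages in
   chronological order, so that a function on [seq A] is a family of functions
   on A^(n-1), n >= 1. *)
Definition stage : Type := (state * action1 * action2)%type.
Definition strategy1 : Type := seq action1 -> dist R action1.
Definition strategy2 : Type := seq stage -> state -> dist R action2.

Definition state_law (h : seq stage) : dist R state :=
  if h is s :: h' then
    let: (x, i, j) := last s h' in transition x i j
  else point_dist s2.

(* Conditional probability of the stage s given the past history h; given h and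
   the current state the two actions are drawn independently. *)
Definition stage_prob (sigma : strategy1) (tau : strategy2) (h : seq stage)
    (s : stage) : R :=
  let: (x, i, j) := s in
  state_law h x * sigma [seq t.1.2 | t <- h] i * tau h x j.

Lemma stage_prob_ge0 sigma tau h s : 0 <= stage_prob sigma tau h s.
Proof.
by case: s => [[x i] j] /=; rewrite mulr_ge0 ?prob_ge0// mulr_ge0 ?prob_ge0.
Qed.

Lemma stage_prob_sum1 sigma tau h : \sum_s stage_prob sigma tau h s = 1.
Proof.
pose F (xi : state * action1) (j : action2) : R :=
  state_law h xi.1 * sigma [seq t.1.2 | t <- h] xi.2 * tau h xi.1 j.
transitivity (\sum_s F s.1 s.2); first by apply: eq_bigr => -[[x i] j].
rewrite -(pair_bigA _ F)/=; under eq_bigr do rewrite -mulr_sumr prob_sum1 mulr1.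
rewrite -(pair_bigA _
  (fun x i => state_law h x * sigma [seq t.1.2 | t <- h] i))/=.
under eq_bigr do rewrite -mulr_sumr prob_sum1 mulr1.
exact: prob_sum1.
Qed.

Definition stage_law sigma tau (h : seq stage) : dist R stage :=
  Dist (stage_prob_ge0 sigma tau h) (stage_prob_sum1 sigma tau h).

End game.

(* A play h is a function on nat; stage n >= 1 is [h n.-1]. *)
Definition cylinder (h : nat -> stage) (n : nat) : set (nat -> stage) :=
  [set h' | forall k, (k < n)%N -> h' k = h k].

Definition cylinders : set (set (nat -> stage)) :=
  [set C | exists h n, C = cylinder h n].

Definition play := g_sigma_algebraType cylinders.

(* Existence of a random sequence with prescribed conditional laws: the
   interval [0, 1[ with Lebesgue measure is split recursively, a history being
   given a subinterval whose length is its probability. The recursion runs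
   over reversed histories; [p] takes its argument in chronological order. *)
Section sequential_law.
Context (R : realType) (p : seq stage -> dist R stage).

Let cum (q : dist R stage) (m : nat) : R :=
  \sum_(b | (enum_rank b < m)%N) q b.

Let cum_ge0 q m : 0 <= cum q m.
Proof. by apply: sumr_ge0 => b _; exact: prob_ge0. Qed.

Let cumS q a : cum q (enum_rank a).+1 = cum q (enum_rank a) + q a.
Proof.
rewrite /cum (bigD1 a)//= addrC; congr (_ + _).
apply: eq_bigl => b; rewrite ltnS ltn_neqAle andbC; congr andb.
by rewrite -(inj_eq enum_rank_inj).
Qed.

Let cum_le q m n : (m <= n)%N -> cum q m <= cum q n.
Proof.
move=> mn; rewrite /cum big_mkcond [leRHS]big_mkcond/=.
apply: ler_sum => b _; case: ifPn => [bm|_]; first by rewrite (leq_trans bm mn).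
by case: ifP => // _; exact: prob_ge0.
Qed.

Let cum0 q : cum q 0 = 0.
Proof. by rewrite /cum big_pred0. Qed.

Let cum_card q : cum q #|{: stage}| = 1.
Proof. by rewrite -(prob_sum1 q); apply: eq_bigl => b; rewrite ltn_ord. Qed.

Fixpoint split_length (r : seq stage) : R :=
  if r is a :: r' then split_length r' * p (rev r') a else 1.

Fixpoint split_start (r : seq stage) : R :=
  if r is a :: r' then
    split_start r' + split_length r' * cum (p (rev r')) (enum_rank a)
  else 0.

Let itv (r : seq stage) (u : R) : bool :=
  (split_start r <= u) && (u < split_start r + split_length r).

Let wt_ge0 r : 0 <= split_length r.
Proof. by elim: r => //= a r ih; rewrite mulr_ge0// prob_ge0. Qed.

Let itv_cons a r u : itv (a :: r) u =
  (split_start r + split_length r * cum (p (rev r)) (enum_rank a) <= u <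
   split_start r + split_length r * cum (p (rev r)) (enum_rank a).+1).
Proof. by rewrite /itv/= cumS mulrDr addrA. Qed.

Let itv_sub a r u : itv (a :: r) u -> itv r u.
Proof.
rewrite itv_cons => /andP[lu ul]; apply/andP; split.
  by apply: le_trans lu; rewrite lerDl mulr_ge0.
apply: (lt_le_trans ul); rewrite lerD2l ler_piMr//.
by rewrite -(cum_card (p (rev r))) cum_le.
Qed.

Let itv_inj a b r u : itv (a :: r) u -> itv (b :: r) u -> a = b.
Proof.
rewrite !itv_cons => /andP[la ua] /andP[lb ub].
have key (c d : stage) :
    u < split_start r + split_length r * cum (p (rev r)) (enum_rank c).+1 ->
    split_start r + split_length r * cum (p (rev r)) (enum_rank d) <= u ->
    (enum_rank d <= enum_rank c)%N.
  move=> uc du; rewrite leqNgt; apply/negP => cd.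
  have := le_lt_trans du uc; rewrite ltrD2l ltNge => /negP; apply.
  by rewrite ler_wpM2l// cum_le.
apply: enum_rank_inj; apply: val_inj; apply/eqP.
by rewrite eqn_leq (key b a)// (key a b).
Qed.

Let itv_cover r u : itv r u -> exists a, itv (a :: r) u.
Proof.
move=> /andP[lu ul].
have ex : exists m, u < split_start r + split_length r * cum (p (rev r)) m.
  by exists #|{: stage}|; rewrite cum_card mulr1.
case: (ex_minnP ex) => -[|m] um min.
  by move: um; rewrite cum0 mulr0 addr0 ltNge lu.
have mA : (m < #|{: stage}|)%N.
  by apply: min; rewrite cum_card mulr1.
exists (enum_val (Ordinal mA)).
rewrite itv_cons enum_valK/= um andbT leNgt; apply/negP => /min.
by rewrite ltnn.
Qed.

Fixpoint split_history (u : R) (n : nat) : seq stage :=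
  if n is m.+1 then
    odflt point [pick a | itv (a :: split_history u m) u] :: split_history u m
  else [::].

Let sample (u : R) : play := fun n => head point (split_history u n.+1).

Let mkseq_sample u n : mkseq (sample u) n = rev (split_history u n).
Proof.
by elim: n => // n ih; rewrite mkseqS ih -rev_cons.
Qed.

Let itv_hist u n : itv [::] u -> itv (split_history u n) u.
Proof.
move=> u01; elim: n => [//|n ih]; rewrite [split_history u n.+1]/=.
case: pickP => [a //|nex].
by have [a uar] := itv_cover ih; have := nex a; rewrite /= uar.
Qed.

Let hist_itv u r : itv r u -> split_history u (size r) = r.
Proof.
elim: r => [//|a r ih uar]; rewrite [LHS]/= ih ?(itv_sub uar)//.
case: pickP => [b ubr|/(_ a)]; last by rewrite uar.
by rewrite /= (itv_inj uar ubr).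
Qed.

Let itv_nil r u : itv r u -> itv [::] u.
Proof. by elim: r => // a r ih /itv_sub. Qed.

Let hist_out u n : ~~ itv [::] u -> split_history u n = nseq n point.
Proof.
move=> u01; elim: n => [//|n ih]; rewrite [LHS]/= ih.
case: pickP => [a /itv_nil|//].
by rewrite (negbTE u01).
Qed.

Let cylinder_mkseq h n (h' : nat -> stage) :
  cylinder h n h' <-> mkseq h' n = mkseq h n.
Proof.
split=> [hh'|hh' k kn].
  apply: (@eq_from_nth _ point) => [|k]; rewrite !size_mkseq// => kn.
  by rewrite !nth_mkseq// hh'.
by have := congr1 (fun s => nth point s k) hh'; rewrite !nth_mkseq.
Qed.

Let sample_cylinder h n u : itv [::] u ->
  cylinder h n (sample u) <-> itv (rev (mkseq h n)) u.
Proof.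
move=> u01; rewrite cylinder_mkseq mkseq_sample; split => [<-|].
  by rewrite revK itv_hist.
by move=> /hist_itv; rewrite size_rev size_mkseq => ->; rewrite revK.
Qed.

Let set_itv r : [set u | itv r u] =
  [set` `[split_start r, split_start r + split_length r[].
Proof. by apply/seteqP; split => u /=; rewrite in_itv. Qed.

Let measurable_itv r : measurable [set u | itv r u].
Proof. by rewrite set_itv; exact: measurable_itv. Qed.

Let measurable_sample : measurable_fun setT sample.
Proof.
apply: (@measurability _ _ _ _ setT sample cylinders erefl).
move=> _ [_ [h [n ->]] <-]; rewrite setTI.
rewrite (_ : _ @^-1` _ = [set u | itv (rev (mkseq h n)) u] `|`
  (~` [set u | itv [::] u] `&` [set _ | nseq n point = rev (mkseq h n)])).
  apply: measurableU => //; apply: measurableI; first exact: measurableC.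
  have [e|ne] := pselect (nseq n point = rev (mkseq h n)).
    by rewrite (_ : [set _ | _] = setT)//; apply/seteqP; split.
  by rewrite (_ : [set _ | _] = set0)//; apply/seteqP; split.
apply/seteqP; split => u /=.
  have [u01 /(sample_cylinder _ _ u01)|u01] := boolP (itv [::] u).
    by left.
  move=> /cylinder_mkseq; rewrite mkseq_sample hist_out// => e; right.
  by split; [exact/negP|rewrite -e revK].
move=> [ur|[/negP u01 e]].
  by apply/sample_cylinder => //; exact: itv_nil ur.
by apply/cylinder_mkseq; rewrite mkseq_sample hist_out// e revK.
Qed.

Let mu01 := mrestr (@lebesgue_measure R) (measurable_itv [::]).

Let pushforward_cylinder h n : pushforward mu01 sample (cylinder h n) =
  (\prod_(k < n) p (mkseq h k) (h k))%:E.
Proof.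
rewrite /pushforward /mu01 /mrestr.
rewrite (_ : _ `&` _ = [set u | itv (rev (mkseq h n)) u]); last first.
  apply/seteqP; split => u /=.
    by move=> [hu u01]; apply/(sample_cylinder h n u01).
  move=> ur; have u01 := itv_nil ur.
  by split=> //; apply/sample_cylinder.
rewrite set_itv lebesgue_measure_itv/= lte_fin ltrDl -EFinB addrAC subrr add0r.
have -> : \prod_(k < n) p (mkseq h k) (h k) = split_length (rev (mkseq h n)).
  elim: n => [|n ih]; first by rewrite big_ord0.
  by rewrite big_ord_recr/= ih mkseqS rev_rcons/= revK.
by case: ltP => // wt0; congr EFin; apply/eqP; rewrite eq_le wt0 wt_ge0.
Qed.

Lemma sequential_law_exists : exists P : probability play R,
  forall h n, P (cylinder h n) = (\prod_(k < n) p (mkseq h k) (h k))%:E.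
Proof.
have P1 : pushforward mu01 sample setT = 1%E.
  have := pushforward_cylinder (fun=> point) 0; rewrite big_ord0 => <-.
  by congr (pushforward _ _ _); apply/seteqP; split.
pose m : {measure set play -> \bar R} :=
  Measure.clone _ _ _ (pushforward mu01 sample) _.
pose P : probability play R := HB.pack (Measure.sort (m measurable_sample))
  (Measure_isProbability.Build _ _ _ (m measurable_sample) P1).
by exists P; exact: pushforward_cylinder.
Qed.

End sequential_law.

Section values.
Context (R : realType).

(* The cylinders, together with the empty set, form a pi-system generating the
   sigma-algebra of [play], so this probability is the only one with the
   prescribed values. *)
Definition play_law (sigma : strategy1 R) (tau : strategy2 R) :
    probability play R :=
  sval (cid (sequential_law_exists (stage_law sigma tau))).

Lemma play_lawE sigma tau h n : play_law sigma tau (cylinder h n) =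
  (\prod_(k < n) stage_law sigma tau (mkseq h k) (h k))%:E.
Proof. exact: (svalP (cid (sequential_law_exists (stage_law sigma tau)))). Qed.

Definition limsup_payoff (h : play) : R :=
  limn_sup (fun n => let: (x, i, j) := h n in stage_payoff R x i j).

Definition expected_payoff (sigma : strategy1 R) (tau : strategy2 R) : \bar R :=
  'E_(play_law sigma tau)[limsup_payoff].

Definition lower_limsup_value : \bar R :=
  ereal_sup [set ereal_inf [set expected_payoff sigma tau | tau in setT]
            | sigma in setT].

Definition upper_limsup_value : \bar R :=
  ereal_inf [set ereal_sup [set expected_payoff sigma tau | sigma in setT]
            | tau in setT].

Definition has_limsup_value : Prop := lower_limsup_value = upper_limsup_value.

End values.

(* Main.v *)
Require Import Defs.
From mathcomp Require Import all_boot all_order all_algebra.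
From mathcomp Require Import all_classical all_reals all_analysis.
From mathcomp Require Import measurable_realfun.
From mathcomp Require Import zify ring lra.

(** Only two things matter in a play: the first stage at which player 1 plays
    [Bottom], and the first stage at which player 2 plays [Right] in [s2]. The
    stage payoff vanishes in [s2] and [s3] and every other state is absorbing,
    so along almost every play the stage payoffs are eventually constant; by
    dominated convergence the expected limsup payoff is the limit of the
    expected stage payoffs ([integral_stage_payoff_cvg]). Write [S n] for the
    probability that player 1 plays [Top] at the first [n] stages and [L n] for
    the probability that player 2 plays [Left] at the first [n] stages as long
    as the play stays in [s2]. Backward induction on the horizon gives the
    expected payoff of the state reached after [n] stages
    ([horizon_payoff], [expected_payoff_cvg]):
      1/2 * \sum_(k < n) (S k.+1 * L k - S k * L k.+1) - S n * (1 - L n).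
    Each of the four bounds is an evaluation of this formula.

    - Lower value. Playing [Bottom] at once guarantees -1/2. Conversely, facing
      a given strategy of player 1, player 2 waits until a stage [M] at which
      [S M] is within epsilon of its infimum and then plays [Right]: from then
      on player 1 hardly ever plays [Bottom] any more, and the payoff is at
      most -1/2 + epsilon.

    - Upper value. Playing [Right] with probability 1/3 at the first stage only
      makes the horizon payoff [S 1 / 6 - 1 / 3], which is at most -1/6.
      Conversely, against a given strategy of player 2, either [L M < 2/3] for
      some [M], and playing [Bottom] for the first time at stage [M] yields at
      least [1/2 - L M > -1/6]; or [L n >= 2/3] for all [n], and playing [Top]
      forever yields the limit of [- (1 - L n) / 2], at least -1/6. *)

Set Implicit Arguments.
Unset Strict Implicit.
Unset Printing Implicit Defensive.

Import Order.TTheory GRing.Theory Num.Theory.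
Import numFieldNormedType.Exports.
Local Open Scope classical_set_scope.
Local Open Scope ring_scope.

(** * Laws of plays on finite prefixes *)

Definition prefix_event (w : seq stage) : set play :=
  [set h | mkseq h (size w) = w].

Lemma prefix_eventE w : prefix_event w = cylinder (nth point w) (size w).
Proof.
apply/seteqP; split => h /=.
  by move=> hw k kw; rewrite -hw nth_mkseq.
move=> hw; apply: (@eq_from_nth _ point); rewrite size_mkseq// => k kw.
by rewrite nth_mkseq// hw.
Qed.

Lemma measurable_prefix_event w : measurable (prefix_event w).
Proof.
rewrite prefix_eventE; apply: sub_sigma_algebra.
by exists (nth point w), (size w).
Qed.

(** There are only countably many words, so a function of finitely many stages
    is measurable without any condition on it. *)
Lemma measurable_finitary (R : realType) (F : seq stage -> R) n :
  measurable_fun [set: play] (fun h : play => F (mkseq h n)).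
Proof.
move=> _ Y mY; rewrite setTI.
pose E w : set play :=
  if (size w == n) && (F w \in Y) then prefix_event w else set0.
rewrite (_ : _ @^-1` Y = \bigcup_w E w).
  apply: countable_bigcupT_measurable => [|w]; first exact: countableP.
  rewrite /E.
  by case: ifP => _ //; exact: measurable_prefix_event.
apply/seteqP; split => [h Yh|h [w _]].
  exists (mkseq h n) => //=.
  by rewrite /E size_mkseq eqxx mem_set// /prefix_event /= size_mkseq.
rewrite /E; case: ifP => // /andP[/eqP wn /set_mem Yw].
by rewrite /prefix_event /= wn => ->.
Qed.

Section play_law_prefix.
Context {R : realType} (sigma : strategy1 R) (tau : strategy2 R).
Local Notation P := (play_law sigma tau).

Definition word_prob (w : seq stage) : R :=
  \prod_(k < size w) stage_law sigma tau (take k w) (nth point w k).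

Lemma word_prob_rcons w s :
  word_prob (rcons w s) = word_prob w * stage_law sigma tau w s.
Proof.
rewrite /word_prob size_rcons big_ord_recr/= -cats1 take_cat ltnn subnn.
rewrite take0 cats0 nth_cat ltnn subnn; congr (_ * _).
apply: eq_bigr => k _; rewrite take_cat nth_cat.
by rewrite ltn_ord.
Qed.

Lemma play_law_prefix_event w : P (prefix_event w) = (word_prob w)%:E.
Proof.
rewrite prefix_eventE play_lawE; congr EFin; apply: eq_bigr => k _.
congr (stage_law _ _ _ _); apply: (@eq_from_nth _ point).
  by rewrite size_mkseq size_take ltn_ord.
by move=> i; rewrite size_mkseq => ik; rewrite nth_mkseq// nth_take.
Qed.

(** The plays having a prefix of probability zero form a countable union of
    null cylinders. *)
Lemma word_prob_mkseq_ae :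
  {ae P, forall h : play, forall n, word_prob (mkseq h n) != 0}.
Proof.
pose N (k : nat) : set play := if unpickle k is Some w then
  (if word_prob w == 0 then prefix_event w else set0) else set0.
apply: (@negligibleS _ _ _ _ (\bigcup_k N k)); last first.
  apply: negligible_bigcup => k; rewrite /N.
  case: unpickle => [w|]; last exact: negligible_set0.
  case: eqP => [w0|_]; last exact: negligible_set0.
  exists (prefix_event w); split => //; first exact: measurable_prefix_event.
  by apply: eq_trans (play_law_prefix_event w) _; rewrite w0.
move=> h /= /existsNP[n /negP]; rewrite negbK => h0.
exists (pickle (mkseq h n)) => //.
by rewrite /N pickleK h0 /prefix_event /= size_mkseq.
Qed.

(** The conditional expectation of [F], read on one more stage, given the past
    [w]. *)
Definition step (F : seq stage -> R) (w : seq stage) : R :=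
  \sum_s stage_law sigma tau w s * F (rcons w s).

(** The event of having prefix [w] is the disjoint union, over the next stage
    [s], of the events of having prefix [rcons w s]. Localizing the integral on a
    prefix makes the induction on [n] possible; [integral_finitary] is the case
    of the empty prefix. *)
Lemma integral_prefix_event (F : seq stage -> R) (C : R) :
    (forall w, `|F w| <= C) -> forall n w,
  (\int[P]_h (\1_(prefix_event w) h * F (mkseq h (size w + n)))%:E =
   (word_prob w * iter n step F w)%:E)%E.
Proof.
move=> FC; elim=> [|n ih] w.
  rewrite addn0 (eq_integral (fun h => (F w)%:E * (\1_(prefix_event w) h)%:E)%E).
    rewrite integralZl//; last exact: integrable_indic (measurable_prefix_event w).
    rewrite integral_indic// ?setIT; last exact: measurable_prefix_event.

    by rewrite mulrC EFinM; congr (_ * _)%E; exact: play_law_prefix_event.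
  move=> h _; rewrite indicE.
  case: (boolP (h \in prefix_event w)) => [|_]; last by rewrite mul0r mule0.
  by rewrite inE => -> /=; rewrite mul1r mule1.
transitivity (\int[P]_h (\sum_s (\1_(prefix_event (rcons w s)) h *
    F (mkseq h (size (rcons w s) + n)))%:E))%E.
  apply: eq_integral => h _; rewrite sumEFin; congr EFin.
  under eq_bigr do rewrite size_rcons addSnnS.
  rewrite -mulr_suml; congr (_ * _); rewrite indicE.
  case: (boolP (h \in prefix_event w)) => hw.
    rewrite (bigD1 (h (size w)))//= big1 ?addr0 ?indicE ?mem_set// => [|s ne].
      rewrite /prefix_event /= size_rcons mkseqS.
      by move: hw; rewrite inE => ->.
    rewrite indicE memNset// /prefix_event /= size_rcons mkseqS.
    by move/rcons_inj => [_ e]; rewrite e eqxx in ne.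
  rewrite big1// => s _; rewrite indicE memNset// /prefix_event /=.
  rewrite size_rcons mkseqS => /rcons_inj [e _].
  by move: hw; rewrite notin_setE; apply.
rewrite integral_sum//; last first.
  move=> s; apply: measurable_bounded_integrable => //.
  - by apply: (@le_lt_trans _ _ 1%E); [exact: probability_le1|exact: ltry].
  - apply: measurable_funM; last exact: measurable_finitary.
    by apply: measurable_indic; exact: measurable_prefix_event.
  - exists C; split; first by rewrite num_real.
    move=> M CM h _ /=; rewrite normrM (le_trans _ (ltW CM))//.
    rewrite -[leRHS]mul1r ler_pM// indicE.
    by case: (_ \in _); rewrite ?normr1 ?normr0 ?ler01.
under eq_bigr do rewrite ih word_prob_rcons -mulrA.
by rewrite sumEFin -mulr_sumr iterS.
Qed.

Lemma integral_finitary (F : seq stage -> R) (C : R) n :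
    (forall w, `|F w| <= C) ->
  (\int[P]_h (F (mkseq h n))%:E = (iter n step F [::])%:E)%E.
Proof.
move=> FC; have := integral_prefix_event FC n [::].
rewrite /word_prob big_ord0 mul1r add0n => <-; apply: eq_integral => h _.
by rewrite indicE mem_set// mul1r.
Qed.

End play_law_prefix.

(** * Almost sure convergence of the stage payoffs *)

(** The two actions passed to [stage_payoff] are arbitrary: [stage_payoffE]. *)
Definition payoff_of_state (R : realType) (x : state) : R :=
  stage_payoff R x Top Left.

Definition absorbing (x : state) : bool :=
  if x is (s2 | s3) then false else true.

Definition stage_state (s : stage) : state := s.1.1.

Lemma stage_payoffE (R : realType) x i j :
  stage_payoff R x i j = payoff_of_state R x.
Proof. by case: x. Qed.

Lemma payoff_of_state_le2 (R : realType) x : `|payoff_of_state R x| <= 2.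
Proof.
rewrite /payoff_of_state; case: x => /=; rewrite ?normr0 ?normrN ?ger0_norm//; lra.
Qed.

Lemma limsup_payoffE (R : realType) (h : play) :
  limsup_payoff R h = limn_sup (fun n => payoff_of_state R (stage_state (h n))).
Proof.
rewrite /limsup_payoff; congr limn_sup; apply/funext => n.
by rewrite /stage_state; case: (h n) => [[x i] j]; rewrite stage_payoffE.
Qed.

Lemma state_law_rcons (R : realType) w x i j :
  state_law R (rcons w (x, i, j)) = transition R x i j.
Proof. by case: w => //= s w; rewrite last_rcons. Qed.

Section sums.
Context {R : realType}.

Lemma sum_point_dist (A : finType) (a : A) (f : A -> R) :
  \sum_b point_dist R a b * f b = f a.
Proof.
rewrite (bigD1 a)//= eqxx mul1r big1 ?addr0// => b /negPf ->.
by rewrite mul0r.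
Qed.

Lemma sum_half_dist (A : finType) (a b : A) (f : A -> R) :
  \sum_c half_dist R a b c * f c = 2^-1 * f a + 2^-1 * f b.
Proof.
rewrite -(sum_point_dist a f) -(sum_point_dist b f) !mulr_sumr -big_split/=.
by apply: eq_bigr => c _; rewrite mulrDl !mulrA.
Qed.

Lemma sum_action1 (f : action1 -> R) : \sum_i f i = f Top + f Bottom.
Proof.
rewrite (reindex action1_of_bool) ?big_bool//.
by exists bool_of_action1 => [[]|] // i _; exact: bool_of_action1K.
Qed.

Lemma sum_action2 (f : action2 -> R) : \sum_j f j = f Left + f Right.
Proof.
rewrite (reindex action2_of_bool) ?big_bool//.
by exists bool_of_action2 => [[]|] // j _; exact: bool_of_action2K.
Qed.

Lemma prob_Bottom (q : dist R action1) : q Bottom = 1 - q Top.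
Proof. by rewrite -(prob_sum1 q) sum_action1 addrC addKr. Qed.

Lemma prob_Right (q : dist R action2) : q Right = 1 - q Left.
Proof. by rewrite -(prob_sum1 q) sum_action2 addrC addKr. Qed.

Lemma prob_le1 (A : finType) (q : dist R A) a : q a <= 1.
Proof.
rewrite -(prob_sum1 q) (bigD1 a)//= lerDl.
by apply: sumr_ge0 => b _; exact: prob_ge0.
Qed.

Lemma sum_stage_law sigma tau w (f : stage -> R) :
  \sum_s stage_law sigma tau w s * f s =
  \sum_x state_law R w x * \sum_i sigma [seq t.1.2 | t <- w] i *
    \sum_j tau w x j * f (x, i, j).
Proof.
pose F (xi : state * action1) (j : action2) : R :=
  stage_law sigma tau w (xi, j) * f (xi, j).
transitivity (\sum_s F s.1 s.2); first by apply: eq_bigr => -[].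
rewrite -(pair_bigA _ F) /F /=.
transitivity (\sum_xi (fun x i => state_law R w x * sigma [seq t.1.2 | t <- w] i *
    \sum_j tau w x j * f (x, i, j)) xi.1 xi.2).
  by apply: eq_bigr => -[x i] _ /=; rewrite mulr_sumr; apply: eq_bigr => j _;
    rewrite mulrA.
rewrite -(pair_bigA _ (fun x i => state_law R w x *
  sigma [seq t.1.2 | t <- w] i * \sum_j tau w x j * f (x, i, j)))/=.
by apply: eq_bigr => x _; rewrite mulr_sumr; apply: eq_bigr => i _; rewrite mulrA.
Qed.

End sums.

Section expected_payoff_limit.
Context {R : realType} (sigma : strategy1 R) (tau : strategy2 R).
Local Notation P := (play_law sigma tau).
Local Notation g := (payoff_of_state R).

Lemma absorbing_persists (h : play) n :
    word_prob sigma tau (mkseq h n.+2) != 0 ->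
    absorbing (stage_state (h n)) ->
  stage_state (h n.+1) = stage_state (h n).
Proof.
rewrite [mkseq h n.+2]mkseqS word_prob_rcons mulf_eq0 negb_or => /andP[_].
rewrite mkseqS /stage_state; case: (h n.+1) => [[y i'] j'].
case: (h n) => [[x i] j] /=; rewrite state_law_rcons => + xabs.
rewrite !mulf_eq0 !negb_or -andbA => /andP[+ _]; apply: contraNeq => yx.
by case: x xabs yx => //= _ /negPf ->.
Qed.

(** Either the play never reaches an absorbing state, and all its stage payoffs
    are 0, or it stays forever in the first one that it reaches. *)
Lemma stage_payoff_cvg (h : play) :
    (forall n, word_prob sigma tau (mkseq h n) != 0) ->
  (fun n => g (stage_state (h n))) @ \oo --> limsup_payoff R h.
Proof.
move=> hpos; rewrite limsup_payoffE.
suff [l hl] : exists l : R, (fun n => g (stage_state (h n))) @ \oo --> l.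
  by rewrite (cvg_limn_inf_sup hl).2.
have [[N habs]|nabs] :=
    pselect (exists n, absorbing (stage_state (h n))); last first.
  exists 0; rewrite (_ : (fun _ => _) = cst 0); first exact: cvg_cst.
  apply/funext => n; have : ~ absorbing (stage_state (h n)).
    by move=> hn; apply: nabs; exists n.
  by case: (stage_state (h n)).
have hN k : stage_state (h (k + N)%N) = stage_state (h N).
  elim: k => // k ih.
  by rewrite addSn -[RHS]ih absorbing_persists// ih.
exists (g (stage_state (h N))).
rewrite -(cvg_shiftn N) (_ : [sequence _]_n = cst (g (stage_state (h N)))).
  exact: cvg_cst.
by apply/funext => k; rewrite /mk_sequence /= hN.
Qed.

Lemma measurable_stage_payoff n :
  measurable_fun [set: play] (fun h : play => g (stage_state (h n))).
Proof.
apply: eq_measurable_fun (measurable_finitary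
  (fun w => g (stage_state (nth point w n))) n.+1) => h _.
by rewrite nth_mkseq.
Qed.

Lemma integral_stage_payoff_cvg :
  (\int[P]_h (g (stage_state (h n)))%:E @[n --> \oo] -->
   expected_payoff sigma tau)%E.
Proof.
rewrite /expected_payoff unlock.
have [] // := @dominated_convergence _ _ _ P setT measurableT
  (fun n h => (g (stage_state (h n)))%:E) (EFin \o limsup_payoff R) (cst 2%:E).
- by move=> n; apply/measurable_EFinP; exact: measurable_stage_payoff.
- apply/measurable_EFinP.
  rewrite (_ : limsup_payoff R = fun h : play => limn_sup (fun n => g (stage_state (h n)))).
    apply: (@measurable_fun_limn_sup _ play R setT (fun n (h : play) => g (stage_state (h n)))).
    + move=> h _; exists 2 => _ [n _ <-].
      by have := payoff_of_state_le2 R (stage_state (h n)); rewrite ler_norml => /andP[].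
    + move=> h _; exists (- 2) => _ [n _ <-].
      by have := payoff_of_state_le2 R (stage_state (h n)); rewrite ler_norml => /andP[].
    + by move=> n; exact: measurable_stage_payoff.
  by apply/funext => h; exact: limsup_payoffE.
- apply: filterS (word_prob_mkseq_ae sigma tau) => h hpos _.
  by apply/cvg_EFin; [exact: nearW|exact: stage_payoff_cvg].
- exact: finite_measure_integrable_cst.
- by apply: aeW => h n _; rewrite lee_fin payoff_of_state_le2.
Qed.

End expected_payoff_limit.

(** * Expected payoff at a finite horizon *)

Section finite_horizon.
Context {R : realType} (sigma : strategy1 R) (tau : strategy2 R).
Local Notation P := (play_law sigma tau).
Local Notation g := (payoff_of_state R).
Local Notation acts w := [seq t.1.2 | t <- w].

(** The expected payoff of the state reached after [n] more stages, when the
    past is [w] and the current state [x] is already drawn: unlike the iterates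
    of [step], it can be computed separately in each state. *)
Fixpoint continuation_payoff (n : nat) (w : seq stage) (x : state) : R :=
  if n is m.+1 then
    \sum_i sigma (acts w) i * \sum_j tau w x j *
      \sum_y transition R x i j y * continuation_payoff m (rcons w (x, i, j)) y
  else g x.

(** The left-hand side has one more iteration because the last stage of a word
    contains the state drawn after the previous stages. *)
Lemma iter_step_payoff n w :
  iter n.+1 (step sigma tau) (fun w => g (stage_state (last point w))) w =
  \sum_x state_law R w x * continuation_payoff n w x.
Proof.
elim: n w => [|n ih] w.
  rewrite /= /step sum_stage_law; apply: eq_bigr => x _; congr (_ * _).
  under eq_bigr do under eq_bigr do rewrite last_rcons.
  under eq_bigr do rewrite -mulr_suml prob_sum1 mul1r.
  by rewrite -mulr_suml prob_sum1 mul1r.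
rewrite iterS {1}/step sum_stage_law; apply: eq_bigr => x _ /=.
congr (_ * _); apply: eq_bigr => i _; congr (_ * _); apply: eq_bigr => j _.
by congr (_ * _); rewrite -iterS ih state_law_rcons.
Qed.

Lemma integral_stage_payoff n :
  (\int[P]_h (g (stage_state (h n)))%:E =
   (continuation_payoff n [::] s2)%:E)%E.
Proof.
rewrite -[continuation_payoff _ _ _](sum_point_dist s2 (continuation_payoff n [::])).
rewrite -(iter_step_payoff n [::]) -(@integral_finitary _ _ _ _ 2).
  by apply: eq_integral => h _; rewrite mkseqS last_rcons.
by move=> w; exact: payoff_of_state_le2.
Qed.

Lemma continuation_payoff_absorbing n w x : absorbing x ->
  continuation_payoff n w x = g x.
Proof.
move=> xabs; elim: n w => [//|n ih] w /=.
have tr i j : transition R x i j = point_dist R x.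
  by case: x xabs {ih}.
under eq_bigr => i _ do (under eq_bigr => j _ do
  rewrite tr sum_point_dist ih; rewrite -mulr_suml prob_sum1 mul1r).
by rewrite -mulr_suml prob_sum1 mul1r.
Qed.

(** In [s3] the payoff is 2 once player 1 has played [Bottom], and 0 until
    then. *)
Lemma continuation_payoff_s3 n w : continuation_payoff n w s3 =
  2 * (1 - \prod_(k < n) sigma (acts w ++ nseq k Top) Top).
Proof.
elim: n w => [|n ih] w /=; first by rewrite big_ord0 subrr mulr0.
rewrite sum_action1 prob_Bottom big_ord_recl/= cats0.
rewrite (_ : \sum_j _ = 2 * (1 - \prod_(k < n)
    sigma (acts w ++ nseq k.+1 Top) Top)); last first.
  under eq_bigr do rewrite sum_point_dist ih map_rcons /=.
  rewrite -mulr_suml prob_sum1 mul1r.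
  by under eq_bigr do rewrite cat_rcons.
rewrite (_ : \sum_j _ = g abs_2); last first.
  under eq_bigr do rewrite sum_point_dist continuation_payoff_absorbing//.
  by rewrite -mulr_suml prob_sum1 mul1r.
rewrite /payoff_of_state /=; set p := sigma _ _; set q := \prod_(k < n) _.
ring.
Qed.

(** The only stage that leaves a play in [s2]. *)
Definition waiting : stage := (s2, Top, Left).
(** The probability that player 1 plays [Top] at each of the first [n] stages. *)
Definition survival1 (n : nat) : R := \prod_(k < n) sigma (nseq k Top) Top.
(** The probability that player 2 plays [Left] at each of the first [n] stages
    as long as the play remains in [s2] with player 1 playing [Top]. *)
Definition survival2 (n : nat) : R := \prod_(k < n) tau (nseq k waiting) s2 Left.

Lemma survival1D m n :
  survival1 (m + n) = survival1 m * \prod_(k < n) sigma (nseq (m + k) Top) Top.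
Proof.
elim: n => [|n ih]; first by rewrite addn0 big_ord0 mulr1.
by rewrite addnS /survival1 !big_ord_recr/= -/(survival1 _) ih mulrA.
Qed.

Lemma survival1S n :
  survival1 n.+1 = survival1 n * sigma (nseq n Top) Top.
Proof. by rewrite /survival1 big_ord_recr. Qed.

Lemma survival2S n :
  survival2 n.+1 = survival2 n * tau (nseq n waiting) s2 Left.
Proof. by rewrite /survival2 big_ord_recr. Qed.

Lemma acts_waiting m : acts (nseq m waiting) = nseq m Top.
Proof. by elim: m => //= m ->. Qed.

Lemma rcons_nseq_same (T : Type) m (x : T) : rcons (nseq m x) x = nseq m.+1 x.
Proof. by elim: m => //= m ->. Qed.

(** After [(Top, Right)] the payoff is -1 with probability 1/2, and otherwise 2
    unless player 1 plays [Top] at all the [n] remaining stages: on average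
    [1 / 2 - \prod_(k < n) _]. *)
Lemma continuation_payoff_s2S n m :
  let p := sigma (nseq m Top) Top in
  let q := tau (nseq m waiting) s2 Left in
  continuation_payoff n.+1 (nseq m waiting) s2 =
  p * (q * continuation_payoff n (nseq m.+1 waiting) s2 +
       (1 - q) * (1 / 2 - \prod_(k < n) sigma (nseq (m.+1 + k) Top) Top)) -
  (1 - p) * q / 2.
Proof.
move=> p q /=; rewrite sum_action1 !sum_action2 acts_waiting prob_Bottom.
rewrite prob_Right !sum_point_dist sum_half_dist rcons_nseq_same.
rewrite (@continuation_payoff_absorbing _ _ abs_m1)//.
rewrite (@continuation_payoff_absorbing _ _ abs_mhalf)//.
rewrite (@continuation_payoff_absorbing _ _ abs_0)// continuation_payoff_s3.
rewrite map_rcons acts_waiting rcons_nseq_same.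
under [in LHS]eq_bigr do rewrite -nseqD.
rewrite -/p -/q /payoff_of_state /=; by field.
Qed.

(** Multiplying by the probability of reaching the history [nseq m waiting]
    makes the recursion of [continuation_payoff_s2S] telescope, and avoids
    dividing by survival probabilities that may vanish. *)
Lemma continuation_payoff_s2 n m :
  survival1 m * survival2 m * continuation_payoff n (nseq m waiting) s2 =
  - survival1 (m + n) * (survival2 m - survival2 (m + n)) +
  2^-1 * \sum_(k < n) (survival1 (m + k).+1 * survival2 (m + k) -
                       survival1 (m + k) * survival2 (m + k).+1).
Proof.
elim: n m => [|n ih] m.
  by rewrite addn0 big_ord0 /= subrr /payoff_of_state /= !mulr0 addr0.
rewrite continuation_payoff_s2S/= big_ord_recl/= addn0.
rewrite [X in _ = _ + _ * (_ + X)](eq_bigr (fun k : 'I_n =>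
    survival1 (m.+1 + k).+1 * survival2 (m.+1 + k) -
    survival1 (m.+1 + k) * survival2 (m.+1 + k).+1)); last first.
  by move=> k _; rewrite addSnnS.
have := ih m.+1; rewrite -addSnnS survival1D survival1S survival2S /=.
set A := \prod_(k < n) _; set B := \sum_(k < n) _; set V := continuation_payoff _ _ _.
set p := sigma _ _; set q := tau _ _ _.
set a := survival1 m; set b := survival2 m; set c := survival2 _ => e.
transitivity (a * p * (b * q) * V + (a * p * b * (1 - q) * (1 / 2 - A) -
  a * (1 - p) * b * q / 2)); first by field.
by rewrite e; field.
Qed.

Definition horizon_payoff (n : nat) : R :=
  2^-1 * \sum_(k < n) (survival1 k.+1 * survival2 k -
                       survival1 k * survival2 k.+1) -
  survival1 n * (1 - survival2 n).

Lemma expected_payoff_cvg :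
  ((horizon_payoff n)%:E @[n --> \oo] --> expected_payoff sigma tau)%E.
Proof.
rewrite (_ : (fun n => _) = fun n =>
  (\int[P]_h (g (stage_state (h n)))%:E)%E); first exact: integral_stage_payoff_cvg.
apply/funext => n; rewrite integral_stage_payoff; congr EFin.
have := continuation_payoff_s2 n 0; rewrite {1}/survival1 {1 2}/survival2.
by rewrite !big_ord0 !mul1r => ->; rewrite addrC mulNr.
Qed.

Lemma expected_payoff_le (c : R) N :
    (forall n, (N <= n)%N -> horizon_payoff n <= c) ->
  (expected_payoff sigma tau <= c%:E)%E.
Proof.
move=> uc; apply: (cvge_le _ expected_payoff_cvg).
by exists N => // n /= Nn; rewrite lee_fin uc.
Qed.

Lemma expected_payoff_ge (c : R) N :
    (forall n, (N <= n)%N -> c <= horizon_payoff n) ->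
  (c%:E <= expected_payoff sigma tau)%E.
Proof.
move=> uc; apply: (cvge_ge _ expected_payoff_cvg).
by exists N => // n /= Nn; rewrite lee_fin uc.
Qed.

Lemma survival1_ge0 n : 0 <= survival1 n.
Proof. by apply: prodr_ge0 => k _; exact: prob_ge0. Qed.

Lemma survival2_ge0 n : 0 <= survival2 n.
Proof. by apply: prodr_ge0 => k _; exact: prob_ge0. Qed.

Lemma survival1_le : {homo survival1 : m n / (m <= n)%N >-> n <= m}.
Proof.
apply: homo_leq => // [m n p mn np|n]; first exact: le_trans np mn.
by rewrite survival1S ler_piMr ?survival1_ge0 ?prob_le1.
Qed.

Lemma survival2S_le n : survival2 n.+1 <= survival2 n.
Proof. by rewrite survival2S ler_piMr ?survival2_ge0 ?prob_le1. Qed.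

End finite_horizon.

(** * Evaluation on particular strategies *)

Section strategies.
Context {R : realType}.
Implicit Types (sigma : strategy1 R) (tau : strategy2 R).

Definition always_top : strategy1 R := fun _ => point_dist R Top.

Definition bottom_at (M : nat) : strategy1 R := fun a =>
  point_dist R (if size a == M then Bottom else Top).

Definition right_at (M : nat) : strategy2 R := fun h _ =>
  point_dist R (if size h == M then Right else Left).

Lemma third_dist_ge0 (j : action2) : 0 <= (if j is Left then 2 / 3 else 1 / 3) :> R.
Proof. by case: j; lra. Qed.

Lemma third_dist_sum1 : \sum_(j : action2) (if j is Left then 2 / 3 else 1 / 3) = 1 :> R.
Proof. by rewrite sum_action2; lra. Qed.

Definition right_third : strategy2 R := fun h _ =>
  if h is [::] then Dist third_dist_ge0 third_dist_sum1 else point_dist R Left.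

Lemma survival1_0 sigma : survival1 sigma 0 = 1.
Proof. by rewrite /survival1 big_ord0. Qed.

Lemma survival2_0 tau : survival2 tau 0 = 1.
Proof. by rewrite /survival2 big_ord0. Qed.

Lemma survival1_always_top n : survival1 always_top n = 1.
Proof. by apply: big1 => k _; rewrite /= . Qed.

Lemma survival1_bottom_at M n : survival1 (bottom_at M) n = (n <= M)%:R.
Proof.
elim: n => [|n ih]; first by rewrite survival1_0.
rewrite survival1S ih /bottom_at size_nseq ltn_neqAle.
case: eqP => [->|_] /=; last by rewrite mulr1.
by rewrite mulr0.
Qed.

Lemma survival2_right_at M n : survival2 (right_at M) n = (n <= M)%:R.
Proof.
elim: n => [|n ih]; first by rewrite survival2_0.
rewrite survival2S ih /right_at size_nseq ltn_neqAle.
case: eqP => [->|_] /=; last by rewrite mulr1.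
by rewrite mulr0.
Qed.

Lemma survival2_right_third n : survival2 right_third n.+1 = 2 / 3.
Proof.
elim: n => [|n ih]; first by rewrite survival2S survival2_0 mul1r.
by rewrite survival2S ih /= mulr1.
Qed.

Lemma horizon_payoff_always_top tau n :
  horizon_payoff always_top tau n = - (1 - survival2 tau n) / 2.
Proof.
rewrite /horizon_payoff survival1_always_top.
rewrite (_ : \sum_(k < n) _ = 1 - survival2 tau n); first by field.
elim: n => [|n ih]; first by rewrite big_ord0 survival2_0 subrr.
rewrite big_ord_recr /= ih !survival1_always_top; ring.
Qed.

(** Here [survival1 (bottom_at M)] is the indicator of [n <= M]: the terms of
    the sum telescope up to [M], the term of index [M] is [- survival2 tau M.+1],
    and the later ones vanish. *)
Lemma horizon_payoff_bottom_at M tau n : (M < n)%N ->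
  horizon_payoff (bottom_at M) tau n =
  (1 - survival2 tau M - survival2 tau M.+1) / 2.
Proof.
move=> Mn; rewrite /horizon_payoff survival1_bottom_at leqNgt Mn /=.
rewrite mul0r subr0 mulrC; congr (_ / _).
rewrite -(subnKC Mn); elim: (n - M.+1)%N => {n Mn} [|d ih].
  rewrite addn0 big_ord_recr /= !survival1_bottom_at ltnn leqnn.
  suff H m : (m <= M)%N -> \sum_(k < m) (survival1 (bottom_at M) k.+1 *
      survival2 tau k - survival1 (bottom_at M) k * survival2 tau k.+1) =
      1 - survival2 tau m.
    by rewrite H//=; ring.
  elim: m => [_|m ih mM]; first by rewrite big_ord0 survival2_0 subrr.
  rewrite big_ord_recr /= ih ?(ltnW mM)// !survival1_bottom_at mM (ltnW mM) /=; ring.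
rewrite addnS big_ord_recr /= ih !survival1_bottom_at.
have [-> ->] : (M.+1 + d < M = false /\ (M.+1 + d <= M) = false)%N by split; lia.
by rewrite /=; ring.
Qed.

(** The same telescoping as in [horizon_payoff_bottom_at], with the players
    exchanged; here the last term of [horizon_payoff] does not vanish. *)
Lemma horizon_payoff_right_at M sigma n : (M < n)%N ->
  horizon_payoff sigma (right_at M) n =
  (survival1 sigma M + survival1 sigma M.+1 - 1) / 2 - survival1 sigma n.
Proof.
move=> Mn; rewrite /horizon_payoff survival2_right_at leqNgt Mn /=.
rewrite subr0 mulr1 mulrC; congr (_ / _ - _).
rewrite -(subnKC Mn); elim: (n - M.+1)%N => {n Mn} [|d ih].
  rewrite addn0 big_ord_recr /= !survival2_right_at ltnn leqnn.
  suff H m : (m <= M)%N -> \sum_(k < m) (survival1 sigma k.+1 *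
      survival2 (right_at M) k - survival1 sigma k * survival2 (right_at M) k.+1) =
      survival1 sigma m - 1.
    by rewrite H//=; ring.
  elim: m => [_|m ih mM]; first by rewrite big_ord0 survival1_0 subrr.
  rewrite big_ord_recr /= ih ?(ltnW mM)// !survival2_right_at mM (ltnW mM) /=; ring.
rewrite addnS big_ord_recr /= ih !survival2_right_at.
have [-> ->] : (M.+1 + d < M = false /\ (M.+1 + d <= M) = false)%N by split; lia.
by rewrite /=; ring.
Qed.

Lemma horizon_payoff_right_third sigma n :
  horizon_payoff sigma right_third n.+1 = survival1 sigma 1 / 6 - 1 / 3.
Proof.
rewrite /horizon_payoff survival2_right_third.
rewrite (_ : \sum_(k < n.+1) _ =
  survival1 sigma 1 / 3 - 2 / 3 + 2 / 3 * survival1 sigma n.+1); first by field.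
elim: n => [|n ih].
  by rewrite big_ord_recr big_ord0 /= survival1_0 survival2_0
    survival2_right_third; field.
by rewrite big_ord_recr /= ih !survival2_right_third; ring.
Qed.

(** * The two values *)

Lemma lower_limsup_value_ge : ((- (1 / 2))%:E <= lower_limsup_value R)%E.
Proof.
apply: le_ereal_sup_tmp;
  exists (ereal_inf [set expected_payoff (bottom_at 0) tau | tau in setT]).
  by exists (bottom_at 0).
apply: le_ereal_inf_tmp => _ [tau _ <-].
apply: (@expected_payoff_ge _ _ _ _ 1) => n n0.
rewrite horizon_payoff_bottom_at// survival2_0.
have := survival2S_le tau 0; rewrite survival2_0; lra.
Qed.

(** Player 2 waits until player 1 is unlikely to play [Bottom] for the first
    time at a later stage, and only then plays [Right]. *)
Lemma lower_limsup_value_le : (lower_limsup_value R <= (- (1 / 2))%:E)%E.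
Proof.
apply: ge_ereal_sup => _ [sigma _ <-].
apply/lee_addgt0Pr => e e0; rewrite -EFinD.
have S_inf : has_inf (range (survival1 sigma)).
  split; first by exists (survival1 sigma 0), 0%N.
  by exists 0 => _ [n _ <-]; exact: survival1_ge0.
have [_ [M _ <-] Me] := inf_adherent e0 S_inf.
apply: ge_ereal_inf; exists (expected_payoff sigma (right_at M)).
  by exists (right_at M).
apply: (@expected_payoff_le _ _ _ _ M.+1) => n Mn.
rewrite horizon_payoff_right_at//.
have : inf (range (survival1 sigma)) <= survival1 sigma n.
  by apply: ge_inf; [exact: S_inf.2|exists n].
have := survival1_le sigma (leqnSn M); lra.
Qed.

(** The probability 1/3 of ever playing [Right] equalizes the payoff of playing
    [Top] forever and that of playing [Bottom] late. *)
Lemma upper_limsup_value_le : (upper_limsup_value R <= (- (1 / 6))%:E)%E.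
Proof.
apply: ge_ereal_inf;
  exists (ereal_sup [set expected_payoff sigma right_third | sigma in setT]).
  by exists right_third.
apply: ge_ereal_sup => _ [sigma _ <-].
apply: (@expected_payoff_le _ _ _ _ 1) => -[//|n] _.
rewrite horizon_payoff_right_third.
have := survival1_le sigma (leq0n 1); rewrite survival1_0; lra.
Qed.

(** At the threshold 2/3 for the probability that player 2 keeps playing [Left],
    both replies of player 1 give -1/6. *)
Lemma upper_limsup_value_ge : ((- (1 / 6))%:E <= upper_limsup_value R)%E.
Proof.
apply: le_ereal_inf_tmp => _ [tau _ <-].
have [[M LM]|nLM] := pselect (exists M, survival2 tau M < 2 / 3).
  apply: le_ereal_sup_tmp; exists (expected_payoff (bottom_at M) tau).
    by exists (bottom_at M).
  apply: (@expected_payoff_ge _ _ _ _ M.+1) => n Mn.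
  rewrite horizon_payoff_bottom_at//.
  have := survival2S_le tau M; lra.
apply: le_ereal_sup_tmp; exists (expected_payoff always_top tau).
  by exists always_top.
apply: (@expected_payoff_ge _ _ _ _ 0) => n _.
rewrite horizon_payoff_always_top.
have : 2 / 3 <= survival2 tau n.
  by rewrite leNgt; apply/negP => Ln; apply: nLM; exists n.
lra.
Qed.

End strategies.

Theorem mainTheorem5 (R : realType) :
  ~ has_limsup_value R /\
  lower_limsup_value R = (- (1 / 2))%:E /\
  - (1 / 2) < - (1 / 6) :> R /\
  upper_limsup_value R = (- (1 / 6))%:E.
Proof.
have lowE : lower_limsup_value R = (- (1 / 2))%:E.
  by apply/eqP; rewrite eq_le lower_limsup_value_le lower_limsup_value_ge.
have uppE : upper_limsup_value R = (- (1 / 6))%:E.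
  by apply/eqP; rewrite eq_le upper_limsup_value_le upper_limsup_value_ge.
have lt26 : - (1 / 2) < - (1 / 6) :> R by lra.
split; last by [].
rewrite /has_limsup_value lowE uppE => -[e].
by rewrite e ltxx in lt26.
Qed.
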